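(* Let $T$ be the set of functions $f\in BLO(\mathbb{R})$ such that $\lim_{k\to\infty}\|f-T_kf\|_{BLO}=0$, where $T_kf$ is the truncation of $f$ at levels $\pm k$. Then the following inclusions hold and are both strict: $$L^\infty\subsetneq T\subsetneq \overline{L^\infty}^{BLO}.$$
   Context: Functions are real valued on $\mathbb{R}$; $I$ denotes a generic compact interval of $\mathbb{R}$, $f_I=\frac1{|I|}\int_I f(x)\,dx$, and $\inf_I f$ is the essential infimum of $f$ on $I$. $L^\infty=L^\infty(\mathbb{R})$. $BLO(\mathbb{R})$ (bounded lower oscillation) is the class of $f\in L^1_{loc}(\mathbb{R})$ such that $\|f\|_{BLO}:=\sup_I\,[f_I-\inf_I f]<\infty$. The truncation is $T_kf(x)=k$ if $f(x)\ge k$, $T_kf(x)=f(x)$ if $-k\le f(x)\le k$, and $T_kf(x)=-k$ if $f(x)\le -k$. $\overline{L^\infty}^{BLO}$ is the closure of $L^\infty$ in $BLO$, i.e. the set of $f\in BLO(\mathbb{R})$ with $\inf_{g\in L^\infty}\|f-g\|_{BLO}=0$. *)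

(* Defs.v *)
From HB Require Import structures.
From mathcomp Require Import all_boot all_order all_algebra.
From mathcomp Require Import all_classical all_reals all_analysis.
From mathcomp Require Import ess_sup_inf.

Set Implicit Arguments.
Unset Strict Implicit.
Unset Printing Implicit Defensive.

Import Order.TTheory GRing.Theory Num.Theory.
Import numFieldNormedType.Exports.

Local Open Scope classical_set_scope.
Local Open Scope ring_scope.

(** Elements of the spaces below are functions [R -> R] rather than classes
    modulo a.e. equality; every space is stable under a.e. modification by
    measurable functions. Measurable means Borel measurable. *)

Definition avg (R : realType) (f : R -> R) (a b : R) : R :=
  (b - a)^-1 * \int[lebesgue_measure]_(x in `[a, b]) f x.

(** Essential infimum on [a, b]: restricting the measure makes the complement
    of [a, b] negligible. The value is -oo if f is essentially unbounded below
    on [a, b]. *)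
Definition itv_ess_inf (R : realType) (f : R -> R) (a b : R) : \bar R :=
  ess_inf (mrestr (@lebesgue_measure R) (measurable_itv `[a, b]))
    (EFin \o f).

(** Only meaningful for locally integrable f, because [avg] relies on the
    real-valued integral; it may be +oo. *)
Definition BLO_norm (R : realType) (f : R -> R) : \bar R :=
  ereal_sup [set ((avg f I.1 I.2)%:E - itv_ess_inf f I.1 I.2)%E
            | I in [set I : R * R | I.1 < I.2]].

Definition BLO (R : realType) : set (R -> R) :=
  [set f | locally_integrable [set: R] f /\ (BLO_norm f < +oo)%E].

Definition Linfty (R : realType) : set (R -> R) :=
  [set f | f \in Lfun (@lebesgue_measure R) +oo%E].

(** For k < 0 the clauses of the truncation overlap; only large k matter. *)
Definition trunc_at (R : realType) (k : R) (f : R -> R) : R -> R :=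
  fun x => if k <= f x then k else if - k <= f x then f x else - k.

Definition BLO_trunc (R : realType) : set (R -> R) :=
  [set f | BLO f /\ BLO_norm (f \- trunc_at k f) @[k --> +oo] --> 0%E].

Definition Linfty_BLO_closure (R : realType) : set (R -> R) :=
  [set f | BLO f /\
           ereal_inf [set BLO_norm (f \- g) | g in @Linfty R] = 0%E].

(* Main.v *)
Require Import Defs.
From mathcomp Require Import all_boot all_order all_algebra.
From mathcomp Require Import all_classical all_reals all_analysis.
From mathcomp Require Import ess_sup_inf measurable_realfun ring lra.

(** Truncating a function at a level above the essential supremum of its modulus
    changes nothing almost everywhere, and a truncation of [f] at a level
    [k >= 0] is itself a bounded function within [BLO_norm (f \- trunc_at k f)]
    of [f]. These two remarks give the inclusions
    [Linfty_sub_BLO_trunc] and [BLO_trunc_sub_closure]; what has to be found is,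
    for each of them, a function witnessing that it is strict.

    First witness: [negloglog x = - ln (1 + ln (1 + x ^ 2))], which tends to
    [-oo] at infinity. For [k >= 0] the difference with its truncation is
    [min 0 (k - loglog x)], which is radially decreasing and, between two radii,
    decreases at most [expR (- k)] times as much as [logsq x = ln (1 + x ^ 2)]
    increases, because [ln (1 + u)] has slope at most [expR (- k)] once it
    exceeds [k] ([ln_excess_le]). Since the lower oscillation of [- logsq] is at
    most 4 on every interval ([avg_logsq_le]), the BLO norm of that difference
    is at most [4 * expR (- k)], so [negloglog] is in the class although it is
    unbounded.

    Second witness: [jump_loglog = negloglog + 1_(0, +oo)]. Adding a bounded
    function does not leave the closure of the bounded functions
    ([closureD_Linfty]). But truncation at height [- k] acts on the two
    half-lines at different distances from the origin: with
    [loglog m = k + 1], the function minus its truncation vanishes on [0, m],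
    takes values in [-1, 0] on [-m, 0], and goes down to [-1] near [-m].
    Its mean over [-m, m] is at least [-1/2], so its BLO norm stays bounded away
    from 0 for all [k >= 1] ([BLO_norm_jump_loglog]). *)

Set Implicit Arguments.
Unset Strict Implicit.
Unset Printing Implicit Defensive.

Import Order.TTheory GRing.Theory Num.Theory.
Import numFieldNormedType.Exports.

Local Open Scope classical_set_scope.
Local Open Scope ring_scope.

Section BLO_theory.
Context {R : realType}.
Implicit Types (f g : R -> R) (a b c d e k m t x y C : R).

Local Notation mu := (@lebesgue_measure R).

(** Here [mu] is the bare set function, on which instance search does not find
    the filter attached to the bundled measure. *)
#[local] Instance ae_lebesgue_filter : Filter (almost_everywhere mu).
Proof. exact: (ae_filter_ringOfSetsType mu). Qed.

(** * Means and essential infima on intervals *)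

Lemma ae_itv_witness a b (P : R -> Prop) : a < b ->
  {ae mu, forall x, x \in `[a, b] -> P x} -> exists2 x, x \in `[a, b] & P x.
Proof.
move=> ab [N [mN N0 subN]]; apply: contrapT => noP.
have: (mu `[a, b]%classic <= mu N)%E.
  apply: le_measure; rewrite ?inE//.
  by move=> x xab; apply: subN => /= /(_ xab) Px; apply: noP; exists x.
by rewrite N0 lebesgue_measure_itv/= lte_fin ab -EFinB lee_fin leNgt subr_gt0 ab.
Qed.

(** Turns the measure restricted to [a, b] into a condition on points of
    [a, b], the form in which essential bounds are used below. *)
Lemma itv_ess_inf_geP f a b c :
  (c%:E <= itv_ess_inf f a b)%E <->
  {ae mu, forall x, x \in `[a, b] -> c <= f x}.
Proof.
split.
  move=> /ess_infP [N [mN N0 subN]]; exists (N `&` `[a, b]%classic); split => //.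
    exact: measurableI.
  move=> x /= nP; split; first by apply: subN => /=; rewrite lee_fin; move: nP; tauto.
  by apply: contrapT => nx; apply: nP.
move=> [N [mN N0 subN]]; apply/ess_infP.
exists (N `|` ~` `[a, b]%classic); split.
- by apply: measurableU => //; exact: measurableC.
- change (mu ((N `|` ~` `[a, b]%classic) `&` `[a, b]%classic) = 0%E).
  rewrite setIUl setICl setU0.
  apply/eqP; rewrite eq_le measure_ge0 andbT -N0.
  by apply: le_measure; rewrite ?inE//; exact: measurableI.
- move=> x /=; rewrite lee_fin => nP.
  have [xab|] := pselect (x \in `[a, b]); last by right.
  by left; apply: subN => /= /(_ xab).
Qed.

Lemma locally_integrable_itv f a b :
  locally_integrable [set: R] f -> mu.-integrable `[a, b] (EFin \o f).
Proof.
move=> [mf _ intf]; apply/integrableP; split.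
  by apply/measurable_EFinP; exact: measurable_funS mf.
by have := intf _ (@subsetT _ `[a, b]%classic) (@segment_compact _ a b).
Qed.

Lemma locally_integrable_bounded g C :
  measurable_fun setT g -> {ae mu, forall x, `|g x| <= C} ->
  locally_integrable [set: R] g.
Proof.
move=> mg gC; split => //; first exact: openT.
move=> K _ cK.
have mK : measurable K by exact: compact_measurable.
apply: (@le_lt_trans _ _ (\int[mu]_(x in K) (cst `|C|%:E) x)%E).
  apply: ae_ge0_le_integral => //.
    by apply/measurable_EFinP/measurableT_comp => //; exact: measurable_funS mg.
    by move=> x _; rewrite lee_fin.
  by apply: filterS gC => x gx _; rewrite lee_fin (le_trans gx)// ler_norm.
rewrite integral_cst// lte_mul_pinfty//.
exact: compact_finite_measure.
Qed.

(** On [a, b], [g - f] agrees almost everywhere with its absolute value, whose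
    integral is nonnegative. *)
Lemma le_avg f g a b : a < b ->
  locally_integrable [set: R] f -> locally_integrable [set: R] g ->
  {ae mu, forall x, x \in `[a, b] -> f x <= g x} -> avg f a b <= avg g a b.
Proof.
move=> ab lf lg fg; rewrite /avg ler_pM2l ?invr_gt0 ?subr_gt0//.
have If := locally_integrable_itv a b lf; have Ig := locally_integrable_itv a b lg.
rewrite -subr_ge0 -RintegralB//.
have -> : \int[mu]_(x in `[a, b]) (g x - f x) =
          \int[mu]_(x in `[a, b]) `|g x - f x|.
  congr fine; apply: ae_eq_integral => //.
  - by apply/measurable_EFinP; apply: measurable_funB;
      [case: lg => m _ _|case: lf => m _ _]; exact: measurable_funS m.
  - apply/measurable_EFinP; apply: measurableT_comp => //.
    by apply: measurable_funB;
      [case: lg => m _ _|case: lf => m _ _]; exact: measurable_funS m.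
  by apply: filterS fg => x fgx xab; rewrite ger0_norm// subr_ge0; exact: fgx.
by apply: Rintegral_ge0 => x _.
Qed.

Lemma avg_cst c a b : a < b -> avg (cst c) a b = c.
Proof.
move=> ab; rewrite /avg Rintegral_cst//= lebesgue_measure_itv/= lte_fin ab/=.
by rewrite mulrC mulfK// subr_eq0 gt_eqF.
Qed.

Lemma avgD f g a b :
  locally_integrable [set: R] f -> locally_integrable [set: R] g ->
  avg (f \+ g) a b = avg f a b + avg g a b.
Proof.
move=> lf lg; rewrite /avg RintegralD ?mulrDr//; exact: locally_integrable_itv.
Qed.

Lemma locally_integrable_cst (c : R) :
  locally_integrable [set: R] (cst c).
Proof. by apply: (@locally_integrable_bounded _ `|c|) => //; exact: aeW. Qed.

(** Excludes an infinite essential infimum at the same time as it bounds a finite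
    one. *)
Lemma ereal_le_of_real (z : \bar R) y :
  (forall c, (c%:E <= z)%E -> c <= y) -> (z <= y%:E)%E.
Proof.
case: z => [r| |] H; last exact: leNye.
  by rewrite lee_fin; exact: H.
by have := H (y + 1) (leey _); rewrite leNgt ltrDl ltr01.
Qed.

Lemma itv_ess_inf_le_avg f a b : a < b ->
  locally_integrable [set: R] f -> (itv_ess_inf f a b <= (avg f a b)%:E)%E.
Proof.
move=> ab lf; apply: ereal_le_of_real => c /itv_ess_inf_geP cf.
rewrite -[c](@avg_cst c a b)//; apply: le_avg => //.
exact: locally_integrable_cst.
Qed.

Lemma itv_ess_inf_le f a b c d y : a <= c -> c < d -> d <= b ->
  (forall x, x \in `[c, d] -> f x <= y) -> (itv_ess_inf f a b <= y%:E)%E.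
Proof.
move=> ac cd db fy; apply: ereal_le_of_real => r /itv_ess_inf_geP rf.
have rcd : {ae mu, forall x, x \in `[c, d] -> r <= f x}.
  apply: filterS rf => x + xcd; apply.
  by move: x xcd; apply: subitvP; rewrite subitvE !bnd_simp ac.
by have [x xcd rx] := ae_itv_witness cd rcd; exact: le_trans rx (fy _ xcd).
Qed.

(** An essential infimum is at most the mean, so the oscillation on any single
    interval is already nonnegative. *)
Lemma BLO_norm_ge0 f :
  locally_integrable [set: R] f -> (0 <= BLO_norm f)%E.
Proof.
move=> lf; apply: (@le_trans _ _ ((avg f 0 1)%:E - itv_ess_inf f 0 1)%E).
  by rewrite sube_ge0 ?orbT//; exact: itv_ess_inf_le_avg.
by apply: ereal_sup_ubound; exists (0, 1) => //=.
Qed.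

(** Any essential lower bound [c] may replace the essential infimum in an upper
    bound, which spares the computation of the latter. *)
Lemma BLO_norm_le f (M : R) :
  (forall a b, a < b ->
    exists2 c, {ae mu, forall x, x \in `[a, b] -> c <= f x} & avg f a b <= c + M) ->
  (BLO_norm f <= M%:E)%E.
Proof.
move=> H; apply: ge_ereal_sup => _ [[a b] /= ab <-].
have [c /itv_ess_inf_geP cf cM] := H _ _ ab.
apply: (@le_trans _ _ ((avg f a b)%:E - c%:E)%E); first exact: leeB.
by rewrite -EFinB lee_fin lerBlDl.
Qed.

Lemma BLO_norm_bounded g C :
  measurable_fun setT g -> {ae mu, forall x, `|g x| <= C} ->
  (BLO_norm g <= (C *+ 2)%:E)%E.
Proof.
move=> mg gC; apply: BLO_norm_le => a b ab; exists (- C).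
  by apply: filterS gC => x; rewrite ler_norml => /andP[].
rewrite mulr2n addKr -[leRHS](@avg_cst C a b)//; apply: le_avg => //.
- exact: locally_integrable_bounded mg gC.
- exact: locally_integrable_cst.
by apply: filterS gC => x; rewrite ler_norml => /andP[].
Qed.

Lemma BLO_normD_bounded f g C :
  locally_integrable [set: R] f ->
  measurable_fun setT g -> {ae mu, forall x, `|g x| <= C} ->
  (BLO_norm (f \+ g)%R <= BLO_norm f + (C *+ 2)%:E)%E.
Proof.
move=> lf mg gC; have lg := locally_integrable_bounded mg gC.
apply: ge_ereal_sup => _ [[a b] /= ab <-].
have avgg : avg g a b <= C.
  rewrite -[leRHS](@avg_cst C a b)//; apply: le_avg => //.
    exact: locally_integrable_cst.
  by apply: filterS gC => x; rewrite ler_norml => /andP[].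
have infg : (itv_ess_inf f a b - C%:E <= itv_ess_inf (f \+ g)%R a b)%E.
  have := @ess_infD _ _ _ (mrestr mu (measurable_itv `[a, b])) (EFin \o f) (EFin \o g).
  apply: le_trans; apply: leeD => //; rewrite -EFinN.
  apply/(itv_ess_inf_geP g a b (-C)).
  by apply: filterS gC => x; rewrite ler_norml => /andP[].
apply: (@le_trans _ _ ((avg f a b)%:E - itv_ess_inf f a b + (C *+ 2)%:E)%E); last first.
  by apply: leeD => //; apply: ereal_sup_ubound; exists (a, b).
rewrite avgD//; apply: (@le_trans _ _ ((avg f a b + C)%:E - (itv_ess_inf f a b - C%:E))%E).
  by apply: leeB => //; rewrite lee_fin lerD2l.
case: (itv_ess_inf f a b) => [r| |]//=.
by rewrite -!EFinB -!EFinD lee_fin mulr2n; lra.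
Qed.

Lemma LinftyP f :
  Linfty f <-> measurable_fun setT f /\ exists C, {ae mu, forall x, `|f x| <= C}.
Proof.
have mu0 : (0 < mu [set: R])%E.
  apply: (@lt_le_trans _ _ (mu `[0%R:R, 1%R]%classic)).
    by rewrite lebesgue_measure_itv/= lte_fin ltr01 sube0 lte01.
  by apply: le_measure; rewrite ?inE.
have finE : finite_norm mu +oo f = (ess_sup mu (abse \o (EFin \o f)) < +oo)%E.
  by rewrite /finite_norm unlock /= mu0.
rewrite /Linfty /mkset !inE; split.
  move=> /andP[/set_mem mf /set_mem/= /[!finE] fin]; split => //.
  have [c /ess_supP fc] : exists c, (ess_sup mu (abse \o (EFin \o f)) <= c%:E)%E.
    by case: ess_sup fin => [c| |]// _; [exists c|exists 0; exact: leNye].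
  by exists c; apply: filterS fc => x /=; rewrite lee_fin.
move=> [mf [C fC]]; apply/andP; split; apply: mem_set => //=; rewrite finE.
apply: (@le_lt_trans _ _ C%:E); last exact: ltry.
by apply/ess_supP; apply: filterS fC => x; rewrite /= lee_fin.
Qed.

(** * Truncation, bounded functions and the two inclusions *)

Lemma trunc_atE k f : 0 <= k ->
  trunc_at k f = (fun x => Num.max (- k) (Num.min k (f x))).
Proof.
move=> k0; apply/funext => x; rewrite /trunc_at.
case: (leP k (f x)) => kf; last by case: (leP (- k) (f x)).
by rewrite max_r// (le_trans _ k0)// oppr_le0.
Qed.

Lemma trunc_at_normr k f x : 0 <= k -> `|trunc_at k f x| <= k.
Proof.
move=> k0; rewrite /trunc_at ler_norml.
case: (leP k (f x)) => [_|kf]; last case: (leP (- k) (f x)) => fk; lra.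
Qed.

Lemma trunc_at_id k f x : `|f x| <= k -> trunc_at k f x = f x.
Proof.
rewrite ler_norml /trunc_at => /andP[-> fk].
by case: (leP k (f x)) => // kf; apply/eqP; rewrite eq_le kf fk.
Qed.

Lemma measurable_trunc_at k f : 0 <= k ->
  measurable_fun setT f -> measurable_fun setT (trunc_at k f).
Proof.
move=> k0 mf; rewrite trunc_atE//.
by apply: measurable_maxr => //; apply: measurable_minr.
Qed.

Lemma Linfty_trunc_at k f : 0 <= k -> measurable_fun setT f ->
  Linfty (trunc_at k f).
Proof.
move=> k0 mf; apply/LinftyP; split; first exact: measurable_trunc_at.
by exists k; apply: aeW => x; exact: trunc_at_normr.
Qed.

Lemma Linfty_locally_integrable g :
  Linfty g -> locally_integrable [set: R] g.
Proof. by move=> /LinftyP[mg [C gC]]; exact: locally_integrable_bounded mg gC. Qed.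

Lemma BLOD_Linfty f g : BLO f -> Linfty g -> BLO (f \+ g).
Proof.
move=> [lf nf] Lg; split.
  by apply: locally_integrableD => //; exact: Linfty_locally_integrable.
have [mg [C gC]] := (LinftyP g).1 Lg.
apply: le_lt_trans (BLO_normD_bounded lf mg gC) _.
by rewrite lte_add_pinfty// ltry.
Qed.

Lemma Linfty_sub_BLO : @Linfty R `<=` @BLO R.
Proof.
move=> g Lg; split; first exact: Linfty_locally_integrable.
have [mg [C gC]] := (LinftyP g).1 Lg.
by apply: le_lt_trans (BLO_norm_bounded mg gC) _; rewrite ltry.
Qed.

Lemma LinftyD f g : Linfty f -> Linfty g -> Linfty (f \+ g).
Proof.
move=> /LinftyP[mf [C fC]] /LinftyP[mg [D gD]]; apply/LinftyP; split.
  exact: measurable_funD.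
exists (C + D); apply: filterS2 fC gD => x fx gx /=.
by rewrite (le_trans (ler_normD _ _))// lerD.
Qed.

Lemma Linfty_sub_BLO_trunc : @Linfty R `<=` @BLO_trunc R.
Proof.
move=> f Lf; split; first exact: Linfty_sub_BLO.
have [mf [C fC]] := (LinftyP f).1 Lf.
apply: cvg_near_cst; near=> k.
have k0 : 0 <= k by near: k; exact: nbhs_pinfty_ge.
have Ck : C <= k by near: k; apply: nbhs_pinfty_ge; rewrite num_real.
have mh : measurable_fun setT (f \- trunc_at k f).
  by apply: measurable_funB => //; exact: measurable_trunc_at.
have h0 : {ae mu, forall x, `|(f \- trunc_at k f) x| <= 0}.
  apply: filterS fC => x fx /=.
  by rewrite trunc_at_id ?subrr ?normr0// (le_trans fx).
apply/eqP; rewrite eq_le BLO_norm_ge0 ?andbT; last first.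
  exact: locally_integrable_bounded mh h0.
by have := BLO_norm_bounded mh h0; rewrite mul0rn.
Unshelve. all: by end_near. Qed.

Lemma BLO_dist_Linfty_ge0 f : BLO f ->
  (0 <= ereal_inf [set BLO_norm (f \- g)%R | g in @Linfty R])%E.
Proof.
move=> [lf _]; apply: le_ereal_inf_tmp => _ [g Lg <-]; apply: BLO_norm_ge0.
by apply: locally_integrableB => //; exact: Linfty_locally_integrable.
Qed.

Lemma BLO_trunc_sub_closure : @BLO_trunc R `<=` @Linfty_BLO_closure R.
Proof.
move=> f [Bf cf]; split; first exact: Bf.
apply/eqP; rewrite eq_le (BLO_dist_Linfty_ge0 Bf) andbT.
apply: (cvge_ge _ cf); near=> k; apply: ereal_inf_lbound.
exists (trunc_at k f) => //; apply: Linfty_trunc_at.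
  by near: k; exact: nbhs_pinfty_ge.
by case: Bf => -[].
Unshelve. all: by end_near. Qed.

(** Translating by [g] maps bounded approximants of [f] to bounded approximants of
    [f + g] at the same distance. *)
Lemma closureD_Linfty f g :
  Linfty_BLO_closure f -> Linfty g -> Linfty_BLO_closure (f \+ g).
Proof.
move=> [Bf cf] Lg; have Bfg := BLOD_Linfty Bf Lg; split; first exact: Bfg.
apply/eqP; rewrite eq_le (BLO_dist_Linfty_ge0 Bfg) andbT -cf.
apply: ereal_inf_le_tmp => _ [h Lh <-]; exists (h \+ g); first exact: LinftyD.
by congr BLO_norm; apply/funext => x /=; lra.
Qed.

(** * Lower oscillation of the logarithm *)

Definition logsq x := ln (1 + x ^+ 2).

Definition loglog x := ln (1 + logsq x).

Lemma onesq_gt0 x : 0 < 1 + x ^+ 2.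
Proof. by rewrite ltr_pwDl// sqr_ge0. Qed.

Lemma logsq_ge0 x : 0 <= logsq x.
Proof. by rewrite ln_ge0// lerDl sqr_ge0. Qed.

Lemma onelog_gt0 x : 0 < 1 + logsq x.
Proof. by rewrite ltr_pwDl// logsq_ge0. Qed.

Lemma logsq_norm x : logsq `|x| = logsq x.
Proof. by rewrite /logsq real_normK// num_real. Qed.

Lemma le_logsq x y : `|x| <= `|y| -> logsq x <= logsq y.
Proof.
move=> xy; rewrite -[logsq x]logsq_norm -[logsq y]logsq_norm /logsq.
by rewrite ler_ln ?posrE ?onesq_gt0// lerD2l ler_sqr ?nnegrE.
Qed.

Lemma le_loglog x y : `|x| <= `|y| -> loglog x <= loglog y.
Proof.
by move=> xy; rewrite ler_ln ?posrE ?onelog_gt0// lerD2l; exact: le_logsq.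
Qed.

Lemma loglog_ge0 x : 0 <= loglog x.
Proof. by rewrite ln_ge0// lerDl logsq_ge0. Qed.

Lemma ln_sub_le a b : 0 < a -> 0 < b -> ln b - ln a <= (b - a) / a.
Proof.
move=> a0 b0; have ba : b = (1 + (b - a) / a) * a.
  by field; rewrite gt_eqF.
have p : 0 < 1 + (b - a) / a by rewrite -(pmulr_lgt0 _ a0) -ba.
rewrite {1}ba lnM ?posrE// addrK; apply: le_ln1Dx.
by rewrite -subr_gt0 opprK addrC.
Qed.

(** From [(1 + b ^ 2) / (1 + a ^ 2) <= (b / a) ^ 2] and [ln t <= t - 1]. *)
Lemma mul_logsqB_le a b : 0 <= a -> a <= b ->
  a * (logsq b - logsq a) <= (b - a) * 2.
Proof.
rewrite le_eqVlt => /predU1P[<-|a0] ab; first by rewrite mul0r subr0 mulr_ge0.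
have b0 := lt_le_trans a0 ab.
have ba0 : 0 < b / a by rewrite divr_gt0.
have h : logsq b <= logsq a + (ln b - ln a) * 2.
  have -> : logsq a + (ln b - ln a) * 2 = ln ((1 + a ^+ 2) * (b / a) ^+ 2).
    rewrite lnM ?posrE ?onesq_gt0 ?exprn_gt0// lnXn// ln_div ?posrE//.
    by rewrite mulr_natr.
  rewrite ler_ln ?posrE ?onesq_gt0 ?(mulr_gt0 (onesq_gt0 _)) ?exprn_gt0//.
  have -> : (1 + a ^+ 2) * (b / a) ^+ 2 = (b / a) ^+ 2 + b ^+ 2.
    by field; rewrite gt_eqF.
  by rewrite lerD2r exprn_ege1// ler_pdivlMr// mul1r.
have := ln_sub_le a0 b0; rewrite ler_pdivlMr// => h2.
by have := ler_wpM2l (ltW a0) h; lra.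
Qed.

Lemma is_derive_logsq x : is_derive x 1 logsq (2 * x / (1 + x ^+ 2)).
Proof.
have h : is_derive x 1 (fun y : R => 1 + y ^+ 2) (2 * x).
  apply: is_derive_eq; rewrite add0r /GRing.scale/=; ring.
have := @is_derive1_comp _ (@ln R) (fun y : R => 1 + y ^+ 2) _ _ _
  (is_derive1_ln (onesq_gt0 x)) h.
by rewrite mulrC.
Qed.

Lemma continuous_logsq : continuous logsq.
Proof.
move=> x; apply/differentiable_continuous/derivable1_diffP.
exact: (@ex_derive _ _ _ _ _ _ _ (is_derive_logsq x)).
Qed.

Lemma continuous_loglog : continuous loglog.
Proof.
move=> x; apply: (@continuous_comp _ _ _ (fun y => 1 + logsq y) (@ln R)).
  by apply: continuousD; [exact: cst_continuous|exact: continuous_logsq].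
by apply: continuous_ln; exact: onelog_gt0.
Qed.

(** A primitive of [c - logsq]; integration by parts gives its first term. *)
Definition logsq_prim c x := x * (c - logsq x) + 2 * x - 2 * atan x.

Lemma is_derive_logsq_prim c x : is_derive x 1 (logsq_prim c) (c - logsq x).
Proof.
have := is_derive_logsq x; have := is_derive1_atan x => da dl.
apply: is_derive_eq; rewrite /GRing.scale/=.
by field; rewrite gt_eqF// onesq_gt0.
Qed.

Lemma Rintegral_logsq c a b : a < b ->
  \int[mu]_(x in `[a, b]) (c - logsq x) = logsq_prim c b - logsq_prim c a.
Proof.
move=> ab; rewrite /Rintegral (@continuous_FTC2 _ _ (logsq_prim c))//.
- apply: continuous_subspaceT => x.
  by apply: continuousB; [exact: cst_continuous|exact: continuous_logsq].
- have cH x : {for x, continuous (logsq_prim c)}.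
    apply/differentiable_continuous/derivable1_diffP.
    exact: (@ex_derive _ _ _ _ _ _ _ (is_derive_logsq_prim c x)).
  split.
  + move=> x _; exact: (@ex_derive _ _ _ _ _ _ _ (is_derive_logsq_prim c x)).
  + by apply: cvg_at_right_filter; exact: cH.
  + by apply: cvg_at_left_filter; exact: cH.
- move=> x _; rewrite derive1E.
  exact: (@derive_val _ _ _ _ _ _ _ (is_derive_logsq_prim c x)).
Qed.

(** By the primitive, the integral is at most [2 (b - a)] plus the boundary term
    [b (logsq m - logsq b) - a (logsq m - logsq a)]. One half of it vanishes, at
    the end point of modulus [m]; the other half is positive only if the interval
    contains 0, and is then controlled by [mul_logsqB_le]. *)
Lemma avg_logsq_le a b : a < b ->
  avg (fun x => logsq (Num.max `|a| `|b|) - logsq x) a b <= 4.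
Proof.
move=> ab; rewrite /avg Rintegral_logsq// mulrC ler_pdivrMr ?subr_gt0//.
pose m : R := Num.max `|a| `|b|; rewrite -/m /logsq_prim.
have tab : atan a <= atan b by apply: le_atan; exact: ltW.
suff : b * (logsq m - logsq b) - a * (logsq m - logsq a) <= (b - a) * 2.
  move: (logsq m - logsq b) (logsq m - logsq a) (atan a) (atan b) tab => p q u v.
  by move=> uv pq; nra.
rewrite /m; have [ab'|/ltW ba'] := leP `|a| `|b|; rewrite logsq_norm subrr mulr0.
- have h := le_logsq ab'.
  have [a0|/ltW a0] := leP 0 a; first by nra.
  have := mul_logsqB_le (normr_ge0 _) ab'; rewrite !logsq_norm.
  by move: ab'; rewrite ler0_norm//; case: (ger0P b) => b0 ab' h2; lra.
- have h := le_logsq ba'.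
  have [b0|b0] := leP b 0; first by nra.
  have := mul_logsqB_le (normr_ge0 _) ba'; rewrite !logsq_norm.
  by move: ba'; rewrite gtr0_norm//; case: (ger0P a) => a0 ba' h2; lra.
Qed.

Lemma continuous_cst_logsq c : continuous (fun x => c - logsq x).
Proof.
by move=> x; apply: continuousB; [exact: cst_continuous|exact: continuous_logsq].
Qed.

Lemma continuous_locally_integrable f :
  continuous f -> locally_integrable [set: R] f.
Proof.
move=> cf; split; [exact: continuous_measurable_fun|exact: openT|].
move=> K _ cK; have := continuous_compact_integrable cK (continuous_subspaceT cf).
by move=> /integrableP[].
Qed.

(** On [a, b] the infimum is attained at the larger radius
    [m = max |a| |b|], and there the excess over it is dominated by that of
    [- logsq]. *)
Lemma BLO_norm_radial_le f e : 0 <= e -> locally_integrable [set: R] f ->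
  (forall x y, `|x| <= `|y| -> 0 <= f x - f y <= e * (logsq y - logsq x)) ->
  (BLO_norm f <= (e * 4)%:E)%E.
Proof.
move=> e0 lf H; apply: BLO_norm_le => a b ab.
pose m : R := Num.max `|a| `|b|.
have xm x : x \in `[a, b] -> `|x| <= `|m|.
  rewrite in_itv/= => /andP[ax xb].
  rewrite [leRHS]ger0_norm /m ?le_max ?normr_ge0//.
  have [x0|x0] := leP 0 x; apply/orP; [right|left].
    by rewrite !ger0_norm// (le_trans x0).
  by rewrite !ltr0_norm ?lerN2// (le_lt_trans ax).
exists (f m); first by apply: aeW => x /xm /H/andP[]; rewrite subr_ge0.
have lg : locally_integrable [set: R] (fun x => logsq m - logsq x).
  apply: continuous_locally_integrable; exact: continuous_cst_logsq.
have leg : locally_integrable [set: R] (fun x => e * (logsq m - logsq x)).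
  apply: continuous_locally_integrable => x.
  apply: (@continuousM _ _ (cst e) (fun x => logsq m - logsq x)).
    exact: cst_continuous.
  exact: continuous_cst_logsq.
apply: (@le_trans _ _ (avg (cst (f m) \+ (fun x => e * (logsq m - logsq x))) a b)).
  apply: le_avg => //.
    by apply: locally_integrableD => //; exact: locally_integrable_cst.
  by apply: aeW => x /xm /H/andP[_] /=; lra.
rewrite avgD//; last exact: locally_integrable_cst.
rewrite avg_cst// lerD2l /avg RintegralZl//; last exact: locally_integrable_itv.
by rewrite mulrCA ler_wpM2l//; exact: avg_logsq_le.
Qed.

(** * An unbounded function approximated by its truncations *)

(** Above the level [k] the logarithm is [expR (- k)]-Lipschitz: [(ln a - k)^+] is
    [ln (max a (expR k)) - k]. *)
Lemma ln_excess_le k a b : 0 < a -> a <= b ->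
  0 <= Num.min 0 (k - ln a) - Num.min 0 (k - ln b) <= expR (- k) * (b - a).
Proof.
move=> a0 ab; have b0 := lt_le_trans a0 ab; have e0 := expR_gt0 k.
have lab : ln a <= ln b by rewrite ler_ln ?posrE.
have ek : 0 < expR (- k) by exact: expR_gt0.
have eba : 0 <= expR (- k) * (b - a) by rewrite mulr_ge0 ?subr_ge0// ltW.
have [bk|kb] := leP (ln b) k.
  by rewrite !min_l ?subrr ?lexx ?subr_ge0 ?(le_trans lab).
have -> : Num.min 0 (k - ln b) = k - ln b by rewrite min_r// subr_le0 ltW.
have [ak|ka] := leP (ln a) k.
  have -> : Num.min 0 (k - ln a) = 0 by rewrite min_l// subr_ge0.
  have ake : a <= expR k by rewrite -[a]lnK ?posrE// ler_expR.
  apply/andP; split; first by rewrite sub0r opprB subr_ge0 ltW.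
  have := ln_sub_le e0 b0; rewrite expRK expRN sub0r opprB mulrC => h.
  by apply: le_trans h _; rewrite ler_wpM2l ?invr_ge0 ?(ltW e0)// lerB.
have -> : Num.min 0 (k - ln a) = k - ln a by rewrite min_r// subr_le0 ltW.
have kae : expR k <= a by rewrite -[a]lnK ?posrE// ler_expR ltW.
have -> : k - ln a - (k - ln b) = ln b - ln a by lra.
rewrite subr_ge0 lab /= mulrC expRN; apply: le_trans (ln_sub_le a0 b0) _.
by rewrite ler_wpM2l ?subr_ge0// lef_pV2 ?posrE.
Qed.

Definition negloglog x := - loglog x.

Lemma sub_trunc_at_ub k f x : 0 <= k -> f x <= k ->
  f x - trunc_at k f x = Num.min 0 (f x + k).
Proof.
move=> k0 fk; rewrite trunc_atE//= min_r//.
have [h|h] := leP (- k) (f x); rewrite ?subrr ?opprK.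
  by rewrite min_l//; lra.
by rewrite min_r//; lra.
Qed.

Lemma locally_integrable_negloglog : locally_integrable [set: R] negloglog.
Proof.
apply/locally_integrableN/continuous_locally_integrable; exact: continuous_loglog.
Qed.

Lemma BLO_norm_negloglog k : 0 <= k ->
  (BLO_norm (negloglog \- trunc_at k negloglog)%R <= (expR (- k) * 4)%:E)%E.
Proof.
move=> k0; apply: BLO_norm_radial_le; first exact: expR_ge0.
  apply: locally_integrableB; first exact: locally_integrable_negloglog.
  apply/Linfty_locally_integrable/Linfty_trunc_at => //.
  by case: locally_integrable_negloglog.
have nk x : negloglog x <= k by rewrite (le_trans _ k0)// oppr_le0 loglog_ge0.
move=> x y xy /=; rewrite !sub_trunc_at_ub// ![negloglog _ + k]addrC.
have -> : logsq y - logsq x = (1 + logsq y) - (1 + logsq x) by lra.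
by apply: ln_excess_le; rewrite ?onelog_gt0// lerD2l; exact: le_logsq.
Qed.

Lemma BLO_trunc_negloglog : BLO_trunc negloglog.
Proof.
split; first split; first exact: locally_integrable_negloglog.
  have -> : negloglog = negloglog \- trunc_at 0 negloglog.
    apply/funext => x /=; rewrite sub_trunc_at_ub ?oppr_le0 ?loglog_ge0//.
    by rewrite addr0 min_r// oppr_le0 loglog_ge0.
  by apply: le_lt_trans (BLO_norm_negloglog (lexx 0)) _; rewrite ltry.
apply: (@squeeze_cvge _ _ _ _ (cst 0%E) _ (fun k => (expR (- k) * 4)%:E)).
- near=> k; have k0 : 0 <= k by near: k; exact: nbhs_pinfty_ge.
  rewrite BLO_norm_negloglog// andbT; apply: BLO_norm_ge0.
  apply: locally_integrableB; first exact: locally_integrable_negloglog.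
  apply/Linfty_locally_integrable/Linfty_trunc_at => //.
  by case: locally_integrable_negloglog.
- exact: cvg_cst.
- apply: cvg_EFin; first exact: nearW.
  rewrite -[X in _ --> X](mul0r (4 : R)).
  by apply: cvgM; [exact: cvgr_expR|exact: cvg_cst].
Unshelve. all: by end_near. Qed.

Lemma loglog_surj t : 0 <= t -> exists2 x, 0 <= x & loglog x = t.
Proof.
move=> t0; exists (Num.sqrt (expR (expR t - 1) - 1)); first exact: sqrtr_ge0.
rewrite /loglog /logsq sqr_sqrtr; first by rewrite !(subrKC, expRK).
by rewrite subr_ge0 -expR0 ler_expR subr_ge0 ler_expR.
Qed.

Lemma loglog_lt x y : loglog x < loglog y -> `|x| < `|y|.
Proof. by apply: contraTT; rewrite -!leNgt; exact: le_loglog. Qed.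

Lemma negloglog_unbounded : ~ Linfty negloglog.
Proof.
move=> /LinftyP[_ [C nC]].
have C1 : 0 <= `|C| + 1 by rewrite addr_ge0.
have [r r0 rC] := loglog_surj C1.
have r1 : r < r + 1 by rewrite ltrDl.
have nC' : {ae mu, forall x, x \in `[r, r + 1] -> `|negloglog x| <= C}.
  by apply: filterS nC => x nx _.
have [x] := ae_itv_witness r1 nC'.
rewrite in_itv/= => /andP[rx _].
rewrite normrN (ger0_norm (loglog_ge0 x)) leNgt => /negP; apply.
apply: (@lt_le_trans _ _ (`|C| + 1)); first by rewrite ltr_pwDr// ler_norm.
rewrite -rC; apply: le_loglog.
by rewrite (ger0_norm r0) (le_trans rx)// ler_norm.
Qed.

(** * A limit of bounded functions not approximated by its truncations *)

Definition jump : R -> R := \1_`]0, +oo[.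

Lemma jumpE x : jump x = (0 < x)%R%:R.
Proof. by rewrite /jump indicE mem_setE in_itv/= andbT. Qed.

Lemma Linfty_jump : Linfty jump.
Proof.
apply/LinftyP; split; first exact: measurable_indic.
exists 1; apply: aeW => x; rewrite jumpE.
by case: (0 < x); rewrite ?normr1 ?normr0.
Qed.

Definition jump_loglog : R -> R := negloglog \+ jump.

Lemma closure_jump_loglog : Linfty_BLO_closure jump_loglog.
Proof.
apply: closureD_Linfty Linfty_jump.
exact/BLO_trunc_sub_closure/BLO_trunc_negloglog.
Qed.

Lemma avg_half m : 0 < m -> avg (fun x => - \1_`]-oo, 0%R] x) (- m) m = - 2^-1.
Proof.
move=> m0; rewrite /avg.
under eq_Rintegral do rewrite -mulN1r.
rewrite RintegralZl//; last first.
  apply: locally_integrable_itv; apply: locally_integrable_indic => //; exact: openT.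
rewrite /Rintegral integral_indic//=.
have -> : `]-oo, 0%R] `&` `[- m, m] = `[- m, 0]%classic :> set R.
  apply/seteqP; split => x /=; rewrite !in_itv/=.
    by move=> [-> /andP[->]].
  by move=> /andP[-> x0]; rewrite x0 (le_trans x0)// ltW.
rewrite lebesgue_measure_itv/= lte_fin oppr_lt0 m0/=.
by field; lra.
Qed.

(** On [-m, m] with [loglog m = k + 1], the difference [h] vanishes for [x > 0]
    and is at least [-1] for [x <= 0], so its mean is at least [-1/2]. *)
Lemma BLO_norm_jump_loglog k : 1 <= k ->
  ((4^-1)%:E <= BLO_norm (jump_loglog \- trunc_at k jump_loglog)%R)%E.
Proof.
move=> k1; have k0 : 0 <= k by lra.
pose h : R -> R := jump_loglog \- trunc_at k jump_loglog.
have hE x : h x = Num.min 0 (jump x - loglog x + k).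
  rewrite /h /= sub_trunc_at_ub//.
    by rewrite [jump x - _]addrC.
  have := loglog_ge0 x; rewrite /jump_loglog/= /negloglog jumpE.
  by case: (0 < x) => /=; lra.
have lh : locally_integrable [set: R] h.
  have [[lf _] _] := closure_jump_loglog.
  apply: locally_integrableB => //.
  by apply/Linfty_locally_integrable/Linfty_trunc_at => //; case: lf.
have le_norm t : - t < t -> ((avg h (- t) t)%:E - itv_ess_inf h (- t) t <=
    BLO_norm (jump_loglog \- trunc_at k jump_loglog)%R)%E.
  by move=> tt; apply: ereal_sup_ubound; exists (- t, t).
clearbody h.
have k1' : 0 <= k + 1 by lra.
have k3 : 0 <= k + 3/4 by lra.
have [m m0 loglogm] := loglog_surj k1'; have [n n0 loglogn] := loglog_surj k3.
have nm : n < m.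
  rewrite -(ger0_norm m0) -(ger0_norm n0); apply: loglog_lt.
  by rewrite loglogm loglogn; lra.
have mm : - m < m by lra.
have avgh : - 2^-1 <= avg h (- m) m.
  rewrite -(@avg_half m); last by lra.
  apply: le_avg => //.
    by apply: locally_integrableN; apply: locally_integrable_indic => //; exact: openT.
  apply: aeW => x; rewrite in_itv/= => /andP[mx xm].
  have : loglog x <= k + 1.
    rewrite -loglogm; apply: le_loglog.
    by rewrite [leRHS]ger0_norm ?ler_norml ?mx//; lra.
  rewrite hE indicE mem_setE in_itv/= jumpE [0 < x]ltNge.
  by case: (x <= 0) => /= lx; rewrite le_min; apply/andP; split; lra.
(* Any level strictly between k + 1/2 and k + 1 can define n: [-m, -n] then has
   positive length and h stays below the lower bound of the mean there. *)
have infh : (itv_ess_inf h (- m) m <= (- (3/4))%:E)%E.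
  apply: (@itv_ess_inf_le _ _ _ (- m) (- n)) => //; [lra|lra|].
  move=> x; rewrite in_itv/= => /andP[mx xn].
  have lx : k + 3/4 <= loglog x.
    rewrite -loglogn; apply: le_loglog.
    by rewrite (ger0_norm n0) ler0_norm; lra.
  rewrite hE jumpE ltNge (_ : x <= 0) ?ge_min; last by lra.
  by apply/orP; right => /=; lra.
apply: (le_trans _ (le_norm _ mm)).
apply: (@le_trans _ _ ((- 2^-1)%:E - (- (3/4))%:E)%E); last exact: leeB.
by rewrite -EFinB lee_fin; lra.
Qed.

Lemma jump_loglog_notin_trunc : ~ BLO_trunc jump_loglog.
Proof.
move=> [_ cvg0].
suff : ((4^-1)%:E <= (0 : \bar R))%E by rewrite lee_fin; lra.
apply: (cvge_ge _ cvg0); near=> k; apply: BLO_norm_jump_loglog.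
by near: k; apply: nbhs_pinfty_ge; rewrite num_real.
Unshelve. all: by end_near. Qed.

End BLO_theory.

Theorem mainTheorem5 (R : realType) :
  @Linfty R `<` @BLO_trunc R /\ @BLO_trunc R `<` @Linfty_BLO_closure R.
Proof.
split; split.
- exact: Linfty_sub_BLO_trunc.
- by move=> /(_ _ BLO_trunc_negloglog) /negloglog_unbounded.
- exact: BLO_trunc_sub_closure.
- by move=> /(_ _ closure_jump_loglog) /jump_loglog_notin_trunc.
Qed.
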